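(* Let $K$ be a commutative field, let $x_1,\ldots,x_r\in K$ be pairwise distinct, and let $m_1,\ldots,m_r$ be positive integers. Let $h_1,\ldots,h_r\in K[t]$ be the basic Hermite interpolation polynomials defined in the context. Then for all $i,j\in\{1,\ldots,r\}$, $$h_i\equiv\delta_{ij}\quad\bmod (t-x_j)^{m_j},$$ where $\delta_{ij}$ is the Kronecker delta.
   Context: For each $i\in\{1,\ldots,r\}$ set $$\phi_i(t)=\prod_{j\ne i}(t-x_j)^{m_j},\qquad q_i(t)=\frac{\phi_i(t)}{\phi_i(x_i)},\qquad h_i(t)=1-\left(1-q_i(t)\right)^{m_i}=1-\left(1-\prod_{j\ne i}\left(\frac{t-x_j}{x_i-x_j}\right)^{m_j}\right)^{m_i}.$$ The polynomials $h_i$ are called the basic Hermite interpolation polynomials. Empty products equal $1$. *)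

(* Defs.v *)
From mathcomp Require Import all_boot all_order all_algebra.

Set Implicit Arguments.
Unset Strict Implicit.
Unset Printing Implicit Defensive.

Import GRing.Theory.
Local Open Scope ring_scope.

Section BasicHermite.
Variables (K : fieldType) (r : nat) (x : 'I_r -> K) (m : 'I_r -> nat).

Definition hermite_phi (i : 'I_r) : {poly K} :=
  \prod_(j < r | j != i) ('X - (x j)%:P) ^+ m j.

Definition hermite_q (i : 'I_r) : {poly K} :=
  (hermite_phi i).[x i]^-1 *: hermite_phi i.

Definition hermite_h (i : 'I_r) : {poly K} :=
  1 - (1 - hermite_q i) ^+ m i.

(* The closed product form of h_i; it holds even without distinctness of the
   nodes, thanks to the convention 0^-1 = 0. *)
Lemma hermite_hE (i : 'I_r) :
  hermite_h i =
    1 - (1 - \prod_(j < r | j != i)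
               ((x i - x j)^-1 *: ('X - (x j)%:P)) ^+ m j) ^+ m i.
Proof.
rewrite /hermite_h /hermite_q /hermite_phi horner_prod -prodfV -scaler_prod.
congr (1 - (1 - _) ^+ _); apply: eq_bigr => j _.
by rewrite horner_exp hornerXsubC exprZn exprVn.
Qed.

End BasicHermite.

Definition eqmodp (K : fieldType) (p q d : {poly K}) : bool := d %| p - q.

(* Main.v *)
Require Import Defs.
From mathcomp Require Import all_boot all_order all_algebra.

Import GRing.Theory.
Local Open Scope ring_scope.

(** The polynomial [q_i] vanishes to order [m_j] at every node [x_j] other
    than [x_i], and takes the value [1] at [x_i].  The substitution
    [q |-> 1 - (1 - q) ^ m_i] has two fixed points, [0] and [1]: as a
    polynomial in [q] it is a multiple of [q], so it preserves the vanishing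
    of order [m_j] at [x_j]; and it differs from [1] by [- (1 - q) ^ m_i], so
    it improves the agreement with [1] at [x_i] from order [1] to order [m_i].
    The two halves are [hermite_q_dvd_h] (with [dvdp_hermite_q]) and
    [dvdp_1_sub_hermite_q]. *)

(** This is where distinctness of the nodes enters: it makes the
    normalization of [q_i] meaningful. *)
Lemma hermite_phi_node_neq0 (K : fieldType) (r : nat) (x : 'I_r -> K)
    (m : 'I_r -> nat) (i : 'I_r) :
  injective x -> (hermite_phi x m i).[x i] != 0.
Proof.
move=> x_inj; rewrite horner_prod; apply/prodf_neq0 => k k_neq_i.
by rewrite horner_exp hornerXsubC expf_neq0 // subr_eq0 (inj_eq x_inj) eq_sym.
Qed.

Lemma dvdp_1_sub_hermite_q (K : fieldType) (r : nat) (x : 'I_r -> K)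
    (m : 'I_r -> nat) (i : 'I_r) :
  injective x -> 'X - (x i)%:P %| 1 - hermite_q x m i.
Proof.
move=> x_inj; rewrite dvdp_XsubCl rootE hornerD hornerN hornerC hornerZ.
by rewrite mulVf ?subrr // hermite_phi_node_neq0.
Qed.

Lemma dvdp_hermite_q (K : fieldType) (r : nat) (x : 'I_r -> K)
    (m : 'I_r -> nat) (i j : 'I_r) :
  j != i -> ('X - (x j)%:P) ^+ m j %| hermite_q x m i.
Proof.
move=> j_neq_i; rewrite /hermite_q -mul_polyC dvdp_mull //.
by rewrite /hermite_phi (bigD1 j) //= dvdp_mulr.
Qed.

(** With [a = 1 - q_i], this is the factorization of [1 - a ^ m_i] by
    [1 - a = q_i]. *)
Lemma hermite_q_dvd_h (K : fieldType) (r : nat) (x : 'I_r -> K)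
    (m : 'I_r -> nat) (i : 'I_r) :
  hermite_q x m i %| hermite_h x m i.
Proof.
rewrite /hermite_h -dvdpNr opprB subrX1 addrAC subrr sub0r mulNr dvdpNr.
exact: dvdp_mulr.
Qed.

Theorem proposition2p1 (K : fieldType) (r : nat) (x : 'I_r -> K)
    (m : 'I_r -> nat) (x_inj : injective x) (m_gt0 : forall i, (0 < m i)%N)
    (i j : 'I_r) :
  eqmodp (hermite_h x m i) (i == j)%:R (('X - (x j)%:P) ^+ m j).
Proof.
rewrite /eqmodp; have [<-|i_neq_j] := eqVneq i j.
  rewrite /hermite_h addrAC subrr sub0r dvdpNr.
  by apply/dvdp_exp2r/dvdp_1_sub_hermite_q.
rewrite subr0; apply: dvdp_trans (hermite_q_dvd_h _ _ _ _ _).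
by rewrite dvdp_hermite_q // eq_sym.
Qed.
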